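(* Let $\epsilon>0$ and $\delta\in[0,1]$, let $h$ be an $(\epsilon,\delta)$-differentially private learning rule, let $\mathcal{D}$ be a distribution over labelled points, let $S$ be a training set of size $m\ge1$ drawn from $\mathcal{D}$, and let $x$ be a point drawn from $\mathcal{D}$. Then $$\mathrm{LUF}(h,S,x)\le e^{\epsilon}-1+\delta.$$
   Context: Setting: $\mathbf{X}$ is a feature space and $\mathbf{Y}$ a finite set of class labels. A data point is $z=(x,y)\in\mathbf{X}\times\mathbf{Y}$; $\mathcal{D}$ is a probability distribution on $\mathbf{X}\times\mathbf{Y}$, and ''a point $x$ drawn from $\mathcal{D}$'' refers to the feature part. A dataset of size $m$ is $S=(z_1,\dots,z_m)$; $S^{(\setminus i)}$ denotes $S$ with its $i$-th element removed. A learning rule $h$ is a randomized mapping from finite datasets $S$ to models $h_S:\mathbf{X}\to\mathbf{Y}$. Differential privacy: a randomized algorithm $A$ taking datasets as input satisfies $(\epsilon,\delta)$-differential privacy ($\epsilon>0$, $\delta\in[0,1]$) if for all $n\ge 1$, all datasets $S$ of size $n$ and $S'$ of size $n-1$ that differ in a single row (i.e. $S'$ is $S$ with one element removed), and all (measurable) sets $E$ of possible outputs, $\Pr[A(S)\in E]\le e^{\epsilon}\Pr[A(S')\in E]+\delta$. A learning rule $h$ is $(\epsilon,\delta)$-differentially private if the map $S\mapsto h_S$, whose outputs are models, satisfies this; the sets of models $\{f: f(x)=k\}$ for $x\in\mathbf{X}$, $k\in\mathbf{Y}$ (and their complements) are among the admissible events. Leave-one-out unfairness: for a training set $S$ of size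 $m$ and a feature vector $x$, $$\mathrm{LUF}(h,S,x)=\max_{1\le i\le m,\ k\in\mathbf{Y}}\big|\Pr[h_S(x)=k]-\Pr[h_{S^{(\setminus i)}}(x)=k]\big|,$$ with probability over the randomness of $h$ only. *)

(* Defs.v *)
From HB Require Import structures.
From mathcomp Require Import all_boot all_order all_algebra.
From mathcomp Require Import all_classical all_reals all_analysis.

Set Implicit Arguments.
Unset Strict Implicit.
Unset Printing Implicit Defensive.

Import Order.TTheory GRing.Theory Num.Theory.

Local Open Scope classical_set_scope.
Local Open Scope ring_scope.

(* The sigma-algebra is arbitrary; the discrete one is the usual choice for
   class labels, but nothing below depends on it. *)
#[short(type="finMeasurableType")]
HB.structure Definition FinMeasurable d := {T of Finite T & Measurable d T}.

(* S with its i-th element (counted from 0) removed, for i < size S. *)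
Definition remove_nth (T : Type) (i : nat) (S : seq T) : seq T :=
  take i S ++ drop i.+1 S.

(* A randomized algorithm is given by the law of its output on each dataset. *)
Definition randomized_alg (T : Type) d (O : measurableType d) (R : realType) :=
  seq T -> probability O R.

Definition differentially_private (T : Type) d (O : measurableType d)
    (R : realType) (eps delta : R) (A : randomized_alg T O R) : Prop :=
  forall (n : nat) (S S' : seq T), (1 <= n)%N -> size S = n ->
    (exists2 i, (i < n)%N & S' = remove_nth i S) ->
  forall E : set O, measurable E ->
    (A S E <= (expR eps)%:E * A S' E + delta%:E)%E.

(* Datasets of labelled points to random models X -> Y, the sets of models in
   <<s G >> being the admissible events. *)
Definition learning_rule (X : Type) (Y : pointedType) (G : set (set (X -> Y)))
    (R : realType) :=
  randomized_alg (X * Y) (g_sigma_algebraType G) R.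

Section leave_one_out_unfairness.
Context (X : Type) dY (Y : finMeasurableType dY) (G : set (set (X -> Y))).
Context (R : realType).

Definition prob_predict (h : learning_rule G R) (S : seq (X * Y)) (x : X)
    (k : Y) : R :=
  fine (h S [set f : X -> Y | f x = k]).

(* The quantities compared are nonnegative and Y is nonempty, so the default
   value 0 only matters for the empty dataset. *)
Definition LUF (h : learning_rule G R) (S : seq (X * Y)) (x : X) : R :=
  \big[Num.max/0]_(i < size S) \big[Num.max/0]_(k : Y)
    `|prob_predict h S x k - prob_predict h (remove_nth i S) x k|.

End leave_one_out_unfairness.

(* The law of S is the product measure D^m, determined by its values on boxes *)
Definition iid_sample d (W : measurableType d) dZ (Z : measurableType dZ)
    (R : realType) (P : probability W R) (D : probability Z R) (m : nat)
    (S : {RV P >-> m.-tuple Z}) : Prop :=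
  forall A : 'I_m -> set Z, (forall i, measurable (A i)) ->
    distribution P S [set t | forall i, A i (tnth t i)] =
    (\prod_(i < m) D (A i))%E.

Definition feature_draw d (W : measurableType d) dX (X : measurableType dX)
    dY (Y : measurableType dY) (R : realType) (P : probability W R)
    (D : probability (X * Y)%type R) (x : {RV P >-> X}) : Prop :=
  forall B : set X, measurable B ->
    distribution P x B = D [set z | B z.1].

(* Main.v *)
(* With p = Pr[h_S(x) = k] and q = Pr[h_{S \ i}(x) = k], privacy gives
   p - q <= (e^eps - 1) q + delta <= e^eps - 1 + delta.  Privacy only bounds
   the law on the larger dataset by the law on the smaller one; the same bound
   on q - p comes from the complementary event. *)
Require Import Defs.
From HB Require Import structures.
From mathcomp Require Import all_boot all_order all_algebra.
From mathcomp Require Import all_classical all_reals all_analysis.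
From mathcomp Require Import lra.

Import Order.TTheory GRing.Theory Num.Theory.

Local Open Scope classical_set_scope.
Local Open Scope ring_scope.

Section privacy_bound.
Context (T : Type) (d : measure_display) (O : measurableType d) (R : realType).
Variables (eps delta : R) (A : randomized_alg T O R).
Hypotheses (eps_ge0 : 0 <= eps) (hDP : differentially_private eps delta A).
Variables (S : seq T) (i : nat) (i_lt : (i < size S)%N).

Lemma dp_remove_nth_sub (E : set O) : measurable E ->
  fine (A S E) - fine (A (remove_nth i S) E) <= expR eps - 1 + delta.
Proof.
move=> mE.
have S_gt0 : (1 <= size S)%N by exact: leq_ltn_trans i_lt.
have := hDP _ _ _ S_gt0 erefl (ex_intro2 _ _ i i_lt erefl) _ mE.
have := @probability_le1 _ _ _ (A (remove_nth i S)) E mE.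
(* Probabilities are finite, so the privacy inequality in the extended reals becomes one between
   reals. *)
rewrite -(fineK (fin_num_measure (A S) _ mE)).
rewrite -(fineK (fin_num_measure (A (remove_nth i S)) _ mE)).
rewrite -EFinM -EFinD !lee_fin /=.
have : 1 <= expR eps by rewrite -expR0 ler_expR.
(* With [q] the probability on the smaller dataset, the nonlinear ingredient is
   [(expR eps - 1) * (1 - q) >= 0]. *)
nra.
Qed.

Lemma dp_remove_nth_dist (E : set O) : measurable E ->
  `|fine (A S E) - fine (A (remove_nth i S) E)| <= expR eps - 1 + delta.
Proof.
move=> mE; have := dp_remove_nth_sub _ (measurableC mE).
have fineC (P : probability O R) : fine (P (~` E)) = 1 - fine (P E).
  by rewrite probability_setC // fineB // fin_num_measure.
(* The bound for the complement has left side [(1 - p) - (1 - q) = q - p]. *)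
have := dp_remove_nth_sub _ mE; rewrite !fineC ler_norml; lra.
Qed.

End privacy_bound.

Theorem proposition3p3 (R : realType)
    (dX dY dW : measure_display)
    (X : measurableType dX) (Y : finMeasurableType dY)
    (G : set (set (X -> Y)))
    (hG : forall (x : X) (k : Y), <<s G >> [set f : X -> Y | f x = k])
    (eps delta : R) (heps : 0 < eps) (hdelta : 0 <= delta <= 1)
    (h : learning_rule G R) (hDP : differentially_private eps delta h)
    (D : probability (X * Y)%type R)
    (W : measurableType dW) (P : probability W R)
    (m : nat) (hm : (1 <= m)%N)
    (S : {RV P >-> m.-tuple (X * Y)%type}) (hS : iid_sample D S)
    (x : {RV P >-> X}) (hx : feature_draw D x) :
  forall w : W, LUF h (S w) (x w) <= expR eps - 1 + delta.
Proof.
move=> w.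
(* Both maxima in [LUF] start from 0, so the bound must dominate 0 as well as each term. *)
have bound_ge0 : 0 <= expR eps - 1 + delta.
  have : 1 <= expR eps by rewrite -expR0 ler_expR ltW.
  by case/andP: hdelta; lra.
apply: bigmax_le => // i _; apply: bigmax_le => // k _.
(* The event is the set of models sending [x w] to [k], admissible by [hG]. *)
by apply: dp_remove_nth_dist; [exact: ltW|exact: hDP|exact: ltn_ord|exact: hG].
Qed.
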